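(* Both calibration measures $\mathrm{ATB}$ and $\ell_1\text{-}\mathrm{ATB}$ are complete and sound. That is, for $\mathrm{CAL}\in\{\mathrm{ATB},\ \ell_1\text{-}\mathrm{ATB}\}$ and every distribution $J$ on $[0,1]\times\{0,1\}$: (completeness) if $J$ is calibrated, then $\lim_{T\to\infty}\mathbb E_{S\sim J^T}[\mathrm{CAL}(J_S)]=0$; (soundness) if $J$ is not calibrated, then $\liminf_{T\to\infty}\mathbb E_{S\sim J^T}[\mathrm{CAL}(J_S)]>0$.
   Context: A distribution $J$ of $(v,y)\in[0,1]\times\{0,1\}$ is calibrated if $\mathbb E_J[y\mid v]=v$ almost surely. $S\sim J^T$ denotes a sample $S=((v_t,y_t))_{t=1}^T$ of $T$ i.i.d. points from $J$, and $J_S$ is the (empirical) uniform distribution over $S$. For a distribution $J$ of $(v,y)\in[0,1]\times\{0,1\}$, $$\mathrm{ATB}(J)=\mathbb E_{q\sim\mathrm{Unif}([0,1])}\Big[\big(\mathbb E_J[(v-y)\mathbb I[v<q]]\big)^2+\big(\mathbb E_J[(v-y)\mathbb I[v\ge q]]\big)^2\Big],$$ $$\ell_1\text{-}\mathrm{ATB}(J)=\mathbb E_{q\sim\mathrm{Unif}([0,1])}\Big[\big|\mathbb E_J[(v-y)\mathbb I[v<q]]\big|+\big|\mathbb E_J[(v-y)\mathbb I[v\ge q]]\big|\Big].$$ *)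

(* Defs.v *)
From HB Require Import structures.
From mathcomp Require Import all_boot all_order all_algebra.
From mathcomp Require Import all_classical all_reals all_analysis.

Set Implicit Arguments.
Unset Strict Implicit.
Unset Printing Implicit Defensive.

Import Order.TTheory GRing.Theory Num.Theory.
Import numFieldNormedType.Exports.

Local Open Scope classical_set_scope.
Local Open Scope ring_scope.

Section iid_sample.
Context d (X : measurableType d) (R : realType).

Definition tuple_cons n (z : X * n.-tuple X) : n.+1.-tuple X :=
  [tuple of z.1 :: z.2].

Lemma measurable_tuple_cons n : measurable_fun setT (@tuple_cons n).
Proof. exact: measurable_cons. Qed.

HB.instance Definition _ n :=
  isMeasurableFun.Build _ _ _ _ (@tuple_cons n) (@measurable_tuple_cons n).

(* The law P^n of n independent draws from P: the n-fold product measure. *)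
Fixpoint iid (P : probability X R) n : probability (n.-tuple X) R :=
  match n with
  | 0 => \d_([tuple] : 0.-tuple X)
  | m.+1 => distribution (P \x iid P m)%E (@tuple_cons m)
  end.

End iid_sample.

Section empirical.
Context d (X : measurableType d) (R : realType).
Variables (n : nat) (S : n.+1.-tuple X).

(* n + 1 points, so that the uniform distribution over S is a probability.
   The default value of nth is never used. *)
Definition empirical : set X -> \bar R :=
  mscale (n.+1%:R^-1)%:nng
    (msum (fun i => \d_(nth (thead S) S i)) n.+1).

HB.instance Definition _ := Measure.on empirical.

Lemma empirical_setT : empirical setT = 1%E.
Proof.
have -> : empirical setT = ((n.+1%:R^-1)%:E *
    \sum_(i < n.+1) \d_(nth (thead S) S i) [set: X])%E by [].
under eq_bigr do rewrite diracT.
by rewrite sumEFin sumr_const card_ord -EFinM mulVf ?pnatr_eq0.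
Qed.

HB.instance Definition _ :=
  Measure_isProbability.Build _ _ _ empirical empirical_setT.

End empirical.

(* g \o V is a version of the conditional expectation E_P[Y | V]: it is
   sigma(V)-measurable, and it has the same integral as Y on every event of
   sigma(V), i.e., on every V @^-1` B. *)
Definition is_cond_expectation d d' (T : measurableType d)
    (T' : measurableType d') (R : realType) (P : probability T R)
    (Y : T -> R) (V : T -> T') (g : T' -> R) : Prop :=
  [/\ measurable_fun setT g,
      P.-integrable setT (fun t => (g (V t))%:E) &
      forall B : set T', measurable B ->
        (\int[P]_(t in V @^-1` B) (g (V t))%:E =
         \int[P]_(t in V @^-1` B) (Y t)%:E)%E].

Section calibration.
Context (R : realType).

(* A point z is a pair (v, y) with v = z.1 and y = z.2; the label y : bool is
   read as the number z.2%:R. *)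
Implicit Types J : probability (R * bool)%type R.

Definition on_unit_interval J : Prop := J (`[0, 1] `*` [set: bool]) = 1%E.

Definition calibrated J : Prop :=
  exists2 g : R -> R,
    is_cond_expectation J (fun z : R * bool => z.2%:R) fst g &
    {ae J, forall z, g z.1 = z.1}.

Definition bias_lt J (q : R) : R :=
  fine 'E_J[fun z => ((z.1 - z.2%:R) * (z.1 < q)%R%:R)%R].

Definition bias_ge J (q : R) : R :=
  fine 'E_J[fun z => ((z.1 - z.2%:R) * (q <= z.1)%R%:R)%R].

Definition ATB J : R :=
  fine 'E_(uniform_prob (@ltr01 R))[fun q =>
    (bias_lt J q ^+ 2 + bias_ge J q ^+ 2)%R].

Definition l1_ATB J : R :=
  fine 'E_(uniform_prob (@ltr01 R))[fun q =>
    (`|bias_lt J q| + `|bias_ge J q|)%R].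

(* The expectation of CAL(J_S) over S ~ J^T, with T = n + 1 (J_S needs T > 0);
   the shift of the index changes neither the limit nor the lim inf. *)
Definition expected_empirical (CAL : probability (R * bool)%type R -> R) J
    (n : nat) : \bar R :=
  'E_(iid J n.+1)[fun S => CAL (empirical R S)]%E.

Definition complete_measure (CAL : probability (R * bool)%type R -> R) : Prop :=
  forall J, on_unit_interval J -> calibrated J ->
    expected_empirical CAL J n @[n --> \oo] --> 0%E.

Definition sound_measure (CAL : probability (R * bool)%type R -> R) : Prop :=
  forall J, on_unit_interval J -> ~ calibrated J ->
    (0 < limn_einf (expected_empirical CAL J))%E.

End calibration.

(* Main.v *)
Require Import Defs.
From HB Require Import structures.
From mathcomp Require Import all_boot all_order all_algebra.
From mathcomp Require Import all_classical all_reals all_analysis.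
From mathcomp Require Import measurable_realfun ring lra.

(* For a threshold q the two tests (v - y) 1[v < q] and (v - y) 1[v >= q] are
   bounded, and the mean over T independent draws of a bounded test with
   expectation e and variance s has second moment e^2 + s / T.  Exchanging the
   expectation over the sample with the integral over q therefore gives
     ATB(J) <= E_S[ATB(J_S)] <= ATB(J) + 2 / T.
   If ATB(J) = 0 then both tests have expectation zero for a dense set of q,
   hence for every q by left continuity, so that v and y have the same integral
   on all half-lines, hence on all Borel events of v, which is calibration.
   The l1 version is squeezed between multiples of the squared one: x^2 <= |x|
   on [-1, 1], and |x| <= e + x^2 / e for every e > 0. *)

Set Implicit Arguments.
Unset Strict Implicit.
Unset Printing Implicit Defensive.

Import Order.TTheory GRing.Theory Num.Theory.
Import numFieldNormedType.Exports.

Local Open Scope classical_set_scope.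
Local Open Scope ring_scope.

(** * Bounded measurable functions on probability spaces *)

Section bounded_measurable.
Context (R : realType).

(** On a probability space this gives integrability, and it is stable under sums, products, powers
    and composition, so integrability conditions reduce to closure rules. The bound holds
    everywhere, not just almost everywhere, so it survives fixing one coordinate of a product. *)
Definition bounded_measurable d (T : measurableType d) (f : T -> R) : Prop :=
  measurable_fun setT f /\ exists M, forall x, `|f x| <= M.

Section closure.
Context d (T : measurableType d).
Implicit Types f g : T -> R.

Lemma bounded_measurable_cst (c : R) :
  bounded_measurable (fun _ : T => c).
Proof. by split; [exact: measurable_cst|exists `|c|]. Qed.

Lemma bounded_measurableD f g : bounded_measurable f -> bounded_measurable g ->
  bounded_measurable (fun x => f x + g x).
Proof.
move=> [mf [M fM]] [mg [N gN]]; split; first exact: measurable_funD.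
by exists (M + N) => x; rewrite (le_trans (ler_normD _ _)) ?lerD.
Qed.

Lemma bounded_measurableM f g : bounded_measurable f -> bounded_measurable g ->
  bounded_measurable (fun x => f x * g x).
Proof.
move=> [mf [M fM]] [mg [N gN]]; split; first exact: measurable_funM.
by exists (M * N) => x; rewrite normrM ler_pM.
Qed.

Lemma bounded_measurableX f n : bounded_measurable f ->
  bounded_measurable (fun x => f x ^+ n).
Proof.
move=> [mf [M fM]]; split; first exact: measurable_funX.
by exists (M ^+ n) => x; rewrite normrX lerXn2r// nnegrE (le_trans _ (fM x)).
Qed.

Lemma bounded_measurable_comp d' (U : measurableType d') (h : U -> T) f :
  measurable_fun setT h -> bounded_measurable f ->
  bounded_measurable (fun x => f (h x)).
Proof.
by move=> mh [mf [M fM]]; split; [exact: measurableT_comp|exists M].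
Qed.

Lemma bounded_measurable_integrable (P : probability T R) f :
  bounded_measurable f -> P.-integrable setT (EFin \o f).
Proof.
move=> [mf [M fM]]; apply: measurable_bounded_integrable => //.
  by rewrite [X in (X < _)%E]probability_setT ltry.
exists M; split; first exact: num_real.
by move=> x Mx y _; apply: (le_trans (fM y)); exact: ltW.
Qed.

End closure.

Arguments bounded_measurable_cst {d T} c.

(** * Real-valued integrals of bounded functions against a probability *)

Section Rintegral.
Context d (T : measurableType d) (P : probability T R).
Implicit Types f g : T -> R.

Lemma EFin_Rintegral f : bounded_measurable f ->
  (\int[P]_x f x)%:E = (\int[P]_x (f x)%:E)%E.
Proof.
move=> bf; rewrite fineK//; apply: integrable_fin_num => //.
exact: bounded_measurable_integrable.
Qed.

Lemma prob_RintegralD f g : bounded_measurable f -> bounded_measurable g ->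
  \int[P]_x (f x + g x) = \int[P]_x f x + \int[P]_x g x.
Proof. by move=> bf bg; rewrite RintegralD//; exact: bounded_measurable_integrable. Qed.

Lemma prob_RintegralZl c f : bounded_measurable f ->
  \int[P]_x (c * f x) = c * \int[P]_x f x.
Proof. by move=> bf; rewrite RintegralZl//; exact: bounded_measurable_integrable. Qed.

Lemma prob_Rintegral_cst (c : R) : \int[P]_x c = c.
Proof. by rewrite Rintegral_cst// [X in fine X]probability_setT mulr1. Qed.

Lemma prob_le_Rintegral f g : bounded_measurable f -> bounded_measurable g ->
  (forall x, f x <= g x) -> \int[P]_x f x <= \int[P]_x g x.
Proof.
by move=> bf bg fg; apply: le_Rintegral => //; exact: bounded_measurable_integrable.
Qed.

(** The complement of [D] is a null set. This is how the support condition on [0, 1] enters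
    integrals over points and over samples. *)
Lemma eq_Rintegral_full (D : set T) f g : measurable D -> P D = 1%E ->
  measurable_fun setT f -> measurable_fun setT g ->
  (forall x, D x -> f x = g x) -> (\int[P]_x (f x)%:E = \int[P]_x (g x)%:E)%E.
Proof.
move=> mD PD mf mg fg; apply: ae_eq_integral => //; [exact/measurable_EFinP..|].
exists (~` D); split; first exact: measurableC.
  have PDC : P (~` D) = 0%E by rewrite probability_setC// PD subee.
  exact: PDC.
by move=> x /= nfg Dx; apply: nfg => _; rewrite fg.
Qed.

(** The variance, the integral of [(f x - e) ^+ 2] with [e] the mean, is nonnegative; expanding the
    square gives the inequality. *)
Lemma sqr_Rintegral_le f : bounded_measurable f ->
  (\int[P]_x f x) ^+ 2 <= \int[P]_x (f x ^+ 2).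
Proof.
move=> bf; set e := \int[P]_x f x.
have bf2 := bounded_measurableX 2 bf.
have bc c := bounded_measurable_cst c.
have : 0 <= \int[P]_x (f x - e) ^+ 2.
  by apply: Rintegral_ge0 => x _; exact: sqr_ge0.
have -> : \int[P]_x (f x - e) ^+ 2 =
          \int[P]_x (f x ^+ 2 + (- (2 * e) * f x + e ^+ 2)).
  by apply: eq_Rintegral => x _; ring.
rewrite prob_RintegralD//; last first.
  by apply: bounded_measurableD => //; exact: bounded_measurableM.
rewrite prob_RintegralD//; last exact: bounded_measurableM.
by rewrite prob_RintegralZl// prob_Rintegral_cst -/e; nra.
Qed.

End Rintegral.

(** * Fubini for bounded functions on a product of two probabilities *)

Section Fubini.
Context d1 d2 (T1 : measurableType d1) (T2 : measurableType d2).
Context (P : probability T1 R) (Q : probability T2 R).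
Variable f : T1 * T2 -> R.
Hypothesis bf : bounded_measurable f.

Lemma bounded_measurable_pair1 x : bounded_measurable (fun y => f (x, y)).
Proof. by apply: (@bounded_measurable_comp _ _ _ _ (pair x)). Qed.

Lemma bounded_measurable_pair2 y : bounded_measurable (fun x => f (x, y)).
Proof. by apply: (@bounded_measurable_comp _ _ _ _ (fun x => (x, y))). Qed.

Lemma Rintegral12_prod :
  \int[(P \x Q)%E]_z f z = \int[P]_x \int[Q]_y f (x, y).
Proof.
rewrite [LHS]/Rintegral [RHS]/Rintegral -integral12_prod_meas1//.
  congr fine; apply: eq_integral => x _.
  by rewrite EFin_Rintegral//; exact: bounded_measurable_pair1.
exact: (bounded_measurable_integrable (P \x Q)%E bf).
Qed.

Lemma Rintegral21_prod :
  \int[(P \x Q)%E]_z f z = \int[Q]_y \int[P]_x f (x, y).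
Proof.
rewrite [LHS]/Rintegral [RHS]/Rintegral -integral21_prod_meas1//.
  congr fine; apply: eq_integral => x _.
  by rewrite EFin_Rintegral//; exact: bounded_measurable_pair2.
exact: (bounded_measurable_integrable (P \x Q)%E bf).
Qed.

Lemma bounded_measurable_Rintegral :
  bounded_measurable (fun x => \int[Q]_y f (x, y)).
Proof.
split.
  apply: (measurableT_comp (@fine_measurable _ setT measurableT)).
  apply: (@measurable_fubini_F _ _ _ _ _ P Q (EFin \o f)).
  exact: (bounded_measurable_integrable (P \x Q)%E bf).
have [_ [M fM]] := bf; exists M => x; rewrite ler_norml.
have bx := bounded_measurable_pair1 x.
have bc c := bounded_measurable_cst c.
rewrite -{1}(prob_Rintegral_cst Q (- M)) -{2}(prob_Rintegral_cst Q M).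
by apply/andP; split; apply: prob_le_Rintegral => // y;
  have := fM (x, y); rewrite ler_norml => /andP[].
Qed.

End Fubini.

End bounded_measurable.
Arguments bounded_measurable_cst {R d T} c.

(** * Moments of sample sums *)

Section iid_moments.
Context d (X : measurableType d) (R : realType).
Implicit Types (f : X -> R) (P : probability X R).

Definition sample_sum f n (S : n.-tuple X) : R := \sum_(x <- S) f x.

Lemma sample_sum_tnth f n (S : n.-tuple X) :
  sample_sum f S = \sum_(i < n) f (tnth S i).
Proof. by rewrite /sample_sum big_tuple. Qed.

Lemma sample_sum_cons f n (z : X * n.-tuple X) :
  sample_sum f (tuple_cons z) = f z.1 + sample_sum f z.2.
Proof. by rewrite /sample_sum big_cons. Qed.

Lemma norm_sample_sum_le f n (S : n.-tuple X) : (forall x, `|f x| <= 1) ->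
  `|sample_sum f S| <= n%:R.
Proof.
move=> f1; rewrite sample_sum_tnth (le_trans (ler_norm_sum _ _ _))//.
rewrite (le_trans (ler_sum _ (fun i _ => f1 (tnth S i))))//.
by rewrite sumr_const card_ord.
Qed.

Lemma bounded_measurable_sample_sum f n : bounded_measurable f ->
  bounded_measurable (@sample_sum f n).
Proof.
move=> [mf [M fM]]; split.
  rewrite (_ : @sample_sum f n = fun S => \sum_(i < n) f (tnth S i)); last first.
    by apply/funext => S; rewrite sample_sum_tnth.
  apply: measurable_sum => i; apply: measurableT_comp => //.
  exact: measurable_tnth.
exists (n%:R * M) => S; rewrite sample_sum_tnth (le_trans (ler_norm_sum _ _ _))//.
rewrite (le_trans (ler_sum _ (fun i _ => fM (tnth S i))))//.
by rewrite sumr_const card_ord mulr_natl.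
Qed.

(** Change of variables along [tuple_cons], then Fubini: the first draw is split off from the
    others. The moment computations are inductions on this identity. *)
Lemma Rintegral_iidS P n (F : n.+1.-tuple X -> R) : bounded_measurable F ->
  \int[iid P n.+1]_S F S =
  \int[P]_x \int[iid P n]_S F (tuple_cons (x, S)).
Proof.
move=> bF; rewrite -(Rintegral12_prod _ _ (f := fun z => F (tuple_cons z))).
  rewrite /Rintegral; congr fine.
  apply: (integral_distribution (P := (P \x iid P n)%E)
    (X := @tuple_cons _ X n) (f := EFin \o F)).
    by apply/measurable_EFinP; case: bF.
  apply: (bounded_measurable_integrable (P \x iid P n)%E
    (f := fun z => F (tuple_cons z))).
  apply: bounded_measurable_comp bF; exact: measurable_tuple_cons.
by apply: bounded_measurable_comp bF; exact: measurable_tuple_cons.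
Qed.

Lemma Rintegral_sample_sum P f n : bounded_measurable f ->
  \int[iid P n]_S sample_sum f S = n%:R * \int[P]_x f x.
Proof.
move=> bf; have bs m := @bounded_measurable_sample_sum f m bf.
elim: n => [|n IHn].
  rewrite mul0r -[RHS](prob_Rintegral_cst (iid P 0) 0).
  by apply: eq_Rintegral => S _; rewrite sample_sum_tnth big_ord0.
rewrite Rintegral_iidS//.
transitivity (\int[P]_x (f x + n%:R * \int[P]_x f x)).
  apply: eq_Rintegral => x _.
  transitivity (\int[iid P n]_S (f x + sample_sum f S)).
    by apply: eq_Rintegral => S _; rewrite sample_sum_cons.
  rewrite prob_RintegralD; [|exact: (bounded_measurable_cst _)|exact: bs].
  by rewrite prob_Rintegral_cst IHn.
rewrite prob_RintegralD//; last exact: (bounded_measurable_cst _).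
rewrite prob_Rintegral_cst.
by rewrite -natr1; ring.
Qed.

(** The variance of the sum, n times that of one draw by independence, plus the square of its
    mean. *)
Lemma Rintegral_sqr_sample_sum P f n : bounded_measurable f ->
  \int[iid P n]_S (sample_sum f S ^+ 2) =
  n%:R * (\int[P]_x (f x ^+ 2) - (\int[P]_x f x) ^+ 2) +
  n%:R ^+ 2 * (\int[P]_x f x) ^+ 2.
Proof.
move=> bf; set e := \int[P]_x f x; set e2 := \int[P]_x (f x ^+ 2).
have bs m := @bounded_measurable_sample_sum f m bf.
have bs2 m := bounded_measurableX 2 (bs m).
have bf2 := bounded_measurableX 2 bf.
elim: n => [|n IHn].
  rewrite !mul0r expr0n mul0r addr0 -[RHS](prob_Rintegral_cst (iid P 0) 0).
  by apply: eq_Rintegral => S _; rewrite sample_sum_tnth big_ord0 expr0n.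
rewrite Rintegral_iidS//.
set V := \int[iid P n]_S (sample_sum f S ^+ 2) in IHn.
(* The square of [f x] plus the tail sum is integrated over the tail first: the tail sum has mean
   [n%:R * e], which gives the cross term, and second moment [V]. *)
transitivity (\int[P]_x (f x ^+ 2 + (2 * n%:R * e * f x + V))).
  apply: eq_Rintegral => x _.
  transitivity (\int[iid P n]_S
      (f x ^+ 2 + (2 * f x * sample_sum f S + sample_sum f S ^+ 2))).
    by apply: eq_Rintegral => S _; rewrite sample_sum_cons/=; ring.
  have b2 : bounded_measurable (fun S : n.-tuple X => 2 * f x * sample_sum f S).
    by apply: bounded_measurableM => //; exact: (bounded_measurable_cst _).
  rewrite prob_RintegralD; first last.
  - exact: (bounded_measurableD b2).
  - exact: (bounded_measurable_cst _).
  rewrite (prob_RintegralD _ b2 (bs2 n)) (prob_RintegralZl _ (2 * f x) (bs n)).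
  rewrite prob_Rintegral_cst.
  by rewrite Rintegral_sample_sum// -/e -/V; ring.
have b2 : bounded_measurable (fun x => 2 * n%:R * e * f x).
  by apply: bounded_measurableM => //; exact: (bounded_measurable_cst _).
have bV := bounded_measurable_cst (T := X) V.
rewrite prob_RintegralD//; last exact: (bounded_measurableD b2).
rewrite prob_RintegralD// (prob_RintegralZl _ (2 * n%:R * e) bf).
rewrite prob_Rintegral_cst IHn -/e -/e2.
by rewrite -natr1; ring.
Qed.

(** Almost surely every draw lands in a set of full measure; this carries the support of [J] over to
    samples. *)
Lemma iid_full P n (D : set X) : measurable D -> P D = 1%E ->
  exists2 Dn : set (n.-tuple X), measurable Dn /\ iid P n Dn = 1%E &
    forall S, Dn S -> forall i, D (tnth S i).
Proof.
move=> mD PD.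
pose Dn m : set (m.-tuple X) := [set S | forall i, D (tnth S i)].
have mDn m : measurable (Dn m).
  rewrite (_ : Dn m = \bigcap_(i in [set: 'I_m]) ((@tnth _ X ^~ i) @^-1` D)).
    apply: fin_bigcap_measurable => // i _; rewrite -[_ @^-1` _]setTI.
    exact: measurable_tnth.
  by apply/seteqP; split => [S SD i _|S SD i]; exact: SD.
exists (Dn n); last by [].
split => //; elim: n => [|n IHn].
  rewrite (_ : Dn 0 = setT) ?probability_setT//.
  by apply/seteqP; split => // S _ [].
(* The number 1 is written as the product measure of [D] times [Dn n], which is the preimage of
   [Dn n.+1] under [tuple_cons]. *)
rewrite -[RHS]mule1 -{1}PD -IHn -product_measure1E//=; last exact: mDn.
rewrite /distribution/= /pushforward; congr (_ _).
apply/seteqP; split => [[x S] xS|[x S] [/= Dx DS] i] /=.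
  split => [|i]; first exact: (xS ord0).
  by have := xS (lift ord0 i); rewrite tnthS.
by case: (unliftP ord0 i) => [j ->|->]; [rewrite tnthS; exact: DS|].
Qed.

End iid_moments.

(** * Integrals against the empirical distribution *)

Section empirical_integral.
Context d (X : measurableType d) (R : realType).

Lemma integral_empirical n (S : n.+1.-tuple X) (f : X -> R) :
  measurable_fun setT f ->
  (\int[empirical R S]_x (f x)%:E)%E = (sample_sum f S / n.+1%:R)%:E.
Proof.
move=> mf.
(* The rules for scaled measures and for sums of measures are applied to nonnegative integrands; a
   signed [f] is then split into its positive and negative parts. *)
have ge0_empirical (g : X -> R) : measurable_fun setT g -> (forall x, 0 <= g x) ->
    (\int[empirical R S]_x (g x)%:E)%E = (sample_sum g S / n.+1%:R)%:E.
  move=> mg g0; have mEg : measurable_fun setT (EFin \o g) by exact/measurable_EFinP.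
  rewrite /empirical ge0_integral_mscale//=; last by move=> x _; rewrite lee_fin.
  rewrite ge0_integral_measure_sum//=; last by move=> x _; rewrite lee_fin.
  under eq_bigr do rewrite integral_dirac// diracT mul1e.
  rewrite sumEFin -EFinM mulrC /sample_sum; congr ((_ / _)%:E).
  by rewrite (big_nth (thead S)) big_mkord size_tuple.
rewrite integralE.
rewrite (eq_integral (fun x => (Num.max (f x) 0)%:E)); last first.
  by move=> x _; rewrite funeposE EFin_max.
rewrite [X in (_ - X)%E](eq_integral (fun x => (Num.max (- f x) 0)%:E)); last first.
  by move=> x _; rewrite funenegE EFin_max.
rewrite !ge0_empirical; last 4 first.
- by apply: measurable_maxr => //; exact: measurable_funN.
- by move=> x; rewrite le_max lexx orbT.
- exact: measurable_maxr.
- by move=> x; rewrite le_max lexx orbT.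
rewrite -EFinB -mulrBl /sample_sum -sumrB; congr ((_ / _)%:E).
apply: eq_bigr => x _; rewrite /Num.max; case: ltP => h1; case: ltP => h2; lra.
Qed.

End empirical_integral.

(** * Threshold tests *)

Section split_loss.
Context (R : realType).
Local Notation Z := (R * bool)%type.
Local Notation U := (uniform_prob (@ltr01 R)).
Implicit Types (h : Z -> R) (psi : R -> R) (J : probability Z R).

Definition below h (q : R) (z : Z) : R := h z * (z.1 < q)%R%:R.

Definition above h (q : R) (z : Z) : R := h z * (q <= z.1)%R%:R.

Definition residual (z : Z) : R := z.1 - z.2%:R.

Definition unit_clamp (v : R) : R := Num.max 0 (Num.min v 1).

(* Agrees with the residual on the support of a distribution on [0, 1], and is
   bounded everywhere. *)
Definition clamped_residual (z : Z) : R := unit_clamp z.1 - z.2%:R.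

(** The contribution of one threshold, with [psi] the square or the absolute value, so that both
    measures are treated at once. *)
Definition split_loss psi h n (S : n.-tuple Z) (q : R) : R :=
  psi (sample_sum (below h q) S / n%:R) + psi (sample_sum (above h q) S / n%:R).

(** Unfolds to [ATB] when [psi] is the square and to [l1_ATB] when [psi] is the absolute value. *)
Definition tested_bias psi J : R :=
  fine ('E_U[fun q => (psi (bias_lt J q) + psi (bias_ge J q))%R])%E.

Lemma measurable_natr_bool : measurable_fun setT (fun b : bool => b%:R : R).
Proof. by []. Qed.

Lemma measurable_below d (T : measurableType d) h (z : T -> Z) (q : T -> R) :
  measurable_fun setT h -> measurable_fun setT z -> measurable_fun setT q ->
  measurable_fun setT (fun t => below h (q t) (z t)).
Proof.
move=> mh mz mq; apply: measurable_funM; first exact: measurableT_comp mz.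
apply: (measurableT_comp measurable_natr_bool).
apply: measurable_fun_ltr => //; exact: measurableT_comp mz.
Qed.

Lemma measurable_above d (T : measurableType d) h (z : T -> Z) (q : T -> R) :
  measurable_fun setT h -> measurable_fun setT z -> measurable_fun setT q ->
  measurable_fun setT (fun t => above h (q t) (z t)).
Proof.
move=> mh mz mq; apply: measurable_funM; first exact: measurableT_comp mz.
apply: (measurableT_comp measurable_natr_bool).
apply: measurable_fun_ler => //; exact: measurableT_comp mz.
Qed.

Lemma measurable_residual : measurable_fun setT residual.
Proof.
apply: measurable_funB => //.
exact: (measurableT_comp measurable_natr_bool measurable_snd).
Qed.

Lemma measurable_unit_clamp : measurable_fun setT unit_clamp.
Proof. by apply: measurable_maxr => //; exact: measurable_minr. Qed.

Lemma measurable_clamped_residual : measurable_fun setT clamped_residual.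
Proof.
apply: measurable_funB.
  exact: (measurableT_comp measurable_unit_clamp measurable_fst).
exact: (measurableT_comp measurable_natr_bool measurable_snd).
Qed.

Lemma unit_clamp_itv v : 0 <= unit_clamp v <= 1.
Proof.
by rewrite /unit_clamp le_max lexx/= ge_max ler01 ge_min lexx orbT.
Qed.

Lemma unit_clamp_id v : 0 <= v <= 1 -> unit_clamp v = v.
Proof. by move=> /andP[v0 v1]; rewrite /unit_clamp min_l// max_r. Qed.

Lemma norm_clamped_residual_le z : `|clamped_residual z| <= 1.
Proof.
rewrite /clamped_residual; have /andP[c0 c1] := unit_clamp_itv z.1.
by rewrite ler_norml; case: z.2 => /=; apply/andP; split; lra.
Qed.

Lemma norm_below_le q z : `|below clamped_residual q z| <= 1.
Proof.
rewrite /below; case: (z.1 < q); rewrite ?mulr1 ?mulr0 ?normr0//.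
exact: norm_clamped_residual_le.
Qed.

Lemma norm_above_le q z : `|above clamped_residual q z| <= 1.
Proof.
rewrite /above; case: (q <= z.1); rewrite ?mulr1 ?mulr0 ?normr0//.
exact: norm_clamped_residual_le.
Qed.

Lemma measurable_split_loss psi h n :
  measurable_fun setT psi -> measurable_fun setT h ->
  measurable_fun setT (fun p : n.-tuple Z * R => split_loss psi h p.1 p.2).
Proof.
move=> mpsi mh; rewrite /split_loss; apply: measurable_funD.
  apply: measurableT_comp => //; apply: measurable_funM => //.
  rewrite (_ : (fun _ => _) = fun p : n.-tuple Z * R =>
      \sum_(i < n) below h p.2 (tnth p.1 i)).
    apply: measurable_sum => i; apply: measurable_below => //.
    exact: (measurableT_comp (measurable_tnth i) measurable_fst).
  by apply/funext => p; rewrite sample_sum_tnth.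
apply: measurableT_comp => //; apply: measurable_funM => //.
rewrite (_ : (fun _ => _) = fun p : n.-tuple Z * R =>
    \sum_(i < n) above h p.2 (tnth p.1 i)).
  apply: measurable_sum => i; apply: measurable_above => //.
  exact: (measurableT_comp (measurable_tnth i) measurable_fst).
by apply/funext => p; rewrite sample_sum_tnth.
Qed.

Lemma norm_mean_le n (f : Z -> R) (S : n.-tuple Z) : (forall z, `|f z| <= 1) ->
  `|sample_sum f S / n%:R| <= 1.
Proof.
move=> f1; rewrite normrM normfV normr_nat.
(* For the empty sample the inverse of 0 is 0 by convention, so the mean is 0. *)
case: n S => [|n] S; first by rewrite invr0 mulr0.
by rewrite ler_pdivrMr ?ltr0n// mul1r norm_sample_sum_le.
Qed.

(** Means of the clamped tests lie in [-1, 1], so this local bound makes [split_loss] bounded even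
    though the square is unbounded on the line. *)
Definition unit_bounded psi := forall x, `|x| <= 1 -> 0 <= psi x <= 1.

Lemma bounded_measurable_split_loss psi n :
  measurable_fun setT psi -> unit_bounded psi -> bounded_measurable
    (fun p : n.-tuple Z * R => split_loss psi clamped_residual p.1 p.2).
Proof.
move=> mpsi psi1; split.
  by apply: measurable_split_loss => //; exact: measurable_clamped_residual.
exists 2 => -[S q]/=; rewrite /split_loss.
have /andP[? ?] := psi1 _ (norm_mean_le S (norm_below_le q)).
have /andP[? ?] := psi1 _ (norm_mean_le S (norm_above_le q)).
by rewrite ger0_norm; [lra|exact: addr_ge0].
Qed.

Lemma tested_bias_empirical psi n (S : n.+1.-tuple Z) :
  tested_bias psi (empirical R S) = \int[U]_q split_loss psi residual S q.
Proof.
rewrite /tested_bias unlock; congr fine; apply: eq_integral => q _.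
rewrite /bias_lt /bias_ge /split_loss unlock !integral_empirical//.
- have m : measurable_fun setT (above residual q).
    apply: (@measurable_above _ _ residual idfun (cst q)).
    - exact: measurable_residual.
    - exact: measurable_id.
    - exact: measurable_cst.
  exact: m.
- have m : measurable_fun setT (below residual q).
    apply: (@measurable_below _ _ residual idfun (cst q)).
    - exact: measurable_residual.
    - exact: measurable_id.
    - exact: measurable_cst.
  exact: m.
Qed.

(** Almost every sample has all its points over [0, 1], where the residual and its clamped version
    agree. After this replacement the integrand is bounded, and an integral over the product can be
    evaluated in either order. *)
Lemma expected_empirical_tested_bias psi J n :
  measurable_fun setT psi -> (forall x, 0 <= psi x) -> unit_bounded psi ->
  on_unit_interval J ->
  expected_empirical (tested_bias psi) J n =
  (\int[(iid J n.+1 \x U)%E]_p split_loss psi clamped_residual p.1 p.2)%:E.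
Proof.
move=> mpsi psi0 psi1 J1.
have bs := bounded_measurable_split_loss n.+1 mpsi psi1.
rewrite Rintegral12_prod// EFin_Rintegral; last first.
  exact: (bounded_measurable_Rintegral (iid J n.+1) U bs).
rewrite /expected_empirical unlock.
have mI : measurable (`[0, 1]%classic `*` [set: bool] : set Z).
  exact: measurableX.
have [D [mD D1] DI] := iid_full n.+1 mI J1.
apply: (eq_Rintegral_full (D := D)) => //.
- under eq_fun do rewrite tested_bias_empirical.
  apply: (measurableT_comp (@fine_measurable _ setT measurableT)) => //.
  (* The unclamped residual is unbounded, so measurability in the sample comes from Tonelli, using
     that [psi] is nonnegative everywhere. *)
  apply: (measurable_fun_fubini_tonelli_F (m2 := U)
    (fun p : n.+1.-tuple Z * R => (split_loss psi residual p.1 p.2)%:E)).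
    apply/measurable_EFinP; apply: measurable_split_loss => //.
    exact: measurable_residual.
  by move=> p; rewrite lee_fin addr_ge0.
- by case: (bounded_measurable_Rintegral (iid J n.+1) U bs).
move=> S DS; rewrite tested_bias_empirical; apply: eq_Rintegral => q _ /=.
have eqh z : z \in (S : seq Z) -> residual z = clamped_residual z.
  move=> /tnthP[i ->]; have [/= v01 _] := DI _ DS i.
  by rewrite /residual /clamped_residual unit_clamp_id//; rewrite in_itv/= in v01.
by rewrite /split_loss /sample_sum; congr (psi (_ / _) + psi (_ / _));
  apply: eq_big_seq => z zS; rewrite /below /above eqh.
Qed.

End split_loss.

(** * Population values of the tests and bounds on the expected losses *)

Section test_bias.
Context (R : realType).
Local Notation Z := (R * bool)%type.
Local Notation U := (uniform_prob (@ltr01 R)).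
Implicit Types (J : probability Z R).

Definition test_below J (q : R) : R := \int[J]_z below (@clamped_residual R) q z.

Definition test_above J (q : R) : R := \int[J]_z above (@clamped_residual R) q z.

(** [ATB J] with the residual clamped; the two coincide for [J] on the unit interval. *)
Definition population_ATB J : R :=
  \int[U]_q (test_below J q ^+ 2 + test_above J q ^+ 2).

Lemma bounded_measurable_below q :
  bounded_measurable (below (@clamped_residual R) q).
Proof.
split; last by exists 1 => z; exact: norm_below_le.
apply: (@measurable_below _ _ _ _ idfun (cst q)).
- exact: measurable_clamped_residual.
- exact: measurable_id.
- exact: measurable_cst.
Qed.

Lemma bounded_measurable_above q :
  bounded_measurable (above (@clamped_residual R) q).
Proof.
split; last by exists 1 => z; exact: norm_above_le.
apply: (@measurable_above _ _ _ _ idfun (cst q)).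
- exact: measurable_clamped_residual.
- exact: measurable_id.
- exact: measurable_cst.
Qed.

Lemma bounded_measurable_test_below J : bounded_measurable (test_below J).
Proof.
apply: (bounded_measurable_Rintegral U J
  (f := fun p : R * Z => below (@clamped_residual R) p.1 p.2)).
split; last by exists 1 => z; exact: norm_below_le.
apply: measurable_below => //; exact: measurable_clamped_residual.
Qed.

Lemma bounded_measurable_test_above J : bounded_measurable (test_above J).
Proof.
apply: (bounded_measurable_Rintegral U J
  (f := fun p : R * Z => above (@clamped_residual R) p.1 p.2)).
split; last by exists 1 => z; exact: norm_above_le.
apply: measurable_above => //; exact: measurable_clamped_residual.
Qed.

Lemma bounded_measurable_sqr_test J :
  bounded_measurable (fun q => test_below J q ^+ 2 + test_above J q ^+ 2).
Proof.
by apply: bounded_measurableD; apply: bounded_measurableX;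
  [exact: bounded_measurable_test_below|exact: bounded_measurable_test_above].
Qed.

(** The middle term is the squared expectation plus the variance of [f] divided by the sample size,
    and that variance lies between 0 and 1 because [f] is bounded by 1. *)
Lemma Rintegral_sqr_mean_bounds J (f : Z -> R) n :
  bounded_measurable f -> (forall z, `|f z| <= 1) ->
  (\int[J]_z f z) ^+ 2 <= \int[iid J n.+1]_S ((sample_sum f S / n.+1%:R) ^+ 2)
    <= (\int[J]_z f z) ^+ 2 + n.+1%:R^-1.
Proof.
move=> bf f1; set N : R := n.+1%:R.
have N0 : 0 < N by rewrite ltr0n.
have bs := @bounded_measurable_sample_sum _ _ R f n.+1 bf.
have -> : \int[iid J n.+1]_S ((sample_sum f S / N) ^+ 2) =
    N^-1 * (\int[J]_z (f z ^+ 2) - (\int[J]_z f z) ^+ 2) + (\int[J]_z f z) ^+ 2.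
  transitivity (\int[iid J n.+1]_S (N^-1 ^+ 2 * (sample_sum f S ^+ 2))).
    by apply: eq_Rintegral => S _; rewrite exprMn mulrC.
  rewrite (prob_RintegralZl _ _ (bounded_measurableX 2 bs)).
  by rewrite Rintegral_sqr_sample_sum// -/N; field; rewrite gt_eqF.
have le_e2 := sqr_Rintegral_le J bf.
have e2_1 : \int[J]_z (f z ^+ 2) <= 1.
  rewrite -[leRHS](prob_Rintegral_cst J); apply: prob_le_Rintegral => [||z].
  - exact: bounded_measurableX.
  - exact: (bounded_measurable_cst _).
  - by rewrite -real_normK ?num_real// expr_le1.
have Ni0 : 0 < N^-1 by rewrite invr_gt0.
have sq0 := sqr_ge0 (\int[J]_z f z).
set a := _ - _ ^+ 2; have a0 : 0 <= a by rewrite subr_ge0.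
have a1 : a <= 1 by rewrite /a; lra.
rewrite addrC lerDl lerD2l mulr_ge0//=; last exact: ltW.
by rewrite ler_piMr// ltW.
Qed.

Lemma unit_bounded_sqr : unit_bounded (fun x : R => x ^+ 2).
Proof. by move=> x x1; rewrite sqr_ge0 -real_normK ?num_real// expr_le1. Qed.

Lemma unit_bounded_norm : unit_bounded (fun x : R => `|x|).
Proof. by move=> x x1; rewrite normr_ge0. Qed.

Definition mean_loss (psi : R -> R) J n : R :=
  \int[(iid J n.+1 \x U)%E]_p split_loss psi (@clamped_residual R) p.1 p.2.

(** The bounds are proved for each threshold and then integrated over [q]. Each of the two tests
    contributes at most [n.+1%:R^-1], whence the constant 2. *)
Lemma mean_sqr_loss_bounds J n :
  population_ATB J <= mean_loss (fun x => x ^+ 2) J n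
    <= population_ATB J + 2 / n.+1%:R.
Proof.
have msqr : measurable_fun setT (fun x : R => x ^+ 2) by exact: measurable_funX.
have bs := bounded_measurable_split_loss n.+1 msqr unit_bounded_sqr.
have bsq := bounded_measurable_pair2 bs.
pose Lq q := \int[iid J n.+1]_S
  split_loss (fun x => x ^+ 2) (@clamped_residual R) S q.
have bt := bounded_measurable_sqr_test J.
have Lq_bounds q : test_below J q ^+ 2 + test_above J q ^+ 2 <= Lq q <=
    (test_below J q ^+ 2 + test_above J q ^+ 2) + 2 / n.+1%:R.
  have bb := bounded_measurable_below q; have ba := bounded_measurable_above q.
  rewrite /Lq /split_loss prob_RintegralD.
  - have := Rintegral_sqr_mean_bounds J n bb (norm_below_le q).
    have := Rintegral_sqr_mean_bounds J n ba (norm_above_le q).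
    rewrite -/(test_below J q) -/(test_above J q) => /andP[? ?] /andP[? ?].
    by rewrite mulr_natl mulr2n addrACA !lerD.
  - apply: bounded_measurableX; apply: bounded_measurableM.
      exact: bounded_measurable_sample_sum.
    exact: (bounded_measurable_cst _).
  - apply: bounded_measurableX; apply: bounded_measurableM.
      exact: bounded_measurable_sample_sum.
    exact: (bounded_measurable_cst _).
have bL : bounded_measurable Lq.
  apply: (bounded_measurable_Rintegral U (iid J n.+1) (f := fun p : R * n.+1.-tuple Z =>
    split_loss (fun x => x ^+ 2) (@clamped_residual R) p.2 p.1)).
  apply: (bounded_measurable_comp (h := fun p : R * n.+1.-tuple Z => (p.2, p.1)) _ bs).
  exact: measurable_fun_pair.
have bc := bounded_measurable_cst (T := measurableTypeR R) (2 / n.+1%:R).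
(* Fubini puts the threshold outside, so that the inner integral is a second moment at fixed [q]. *)
rewrite /mean_loss Rintegral21_prod// -/Lq; apply/andP; split.
  by apply: prob_le_Rintegral => // q; have /andP[] := Lq_bounds q.
rewrite -(prob_Rintegral_cst U (2 / n.+1%:R)) -prob_RintegralD//.
apply: prob_le_Rintegral => //; first exact: bounded_measurableD.
by move=> q; have /andP[] := Lq_bounds q.
Qed.

Lemma mean_sqr_loss_le_norm J n :
  mean_loss (fun x => x ^+ 2) J n <= mean_loss (fun x => `|x|) J n.
Proof.
apply: prob_le_Rintegral => [||[S q]].
- exact: (bounded_measurable_split_loss _
    (measurable_funX 2 (@measurable_id _ _ _)) unit_bounded_sqr).
- exact: (bounded_measurable_split_loss _
    (@normr_measurable _ setT) unit_bounded_norm).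
have sqr_le (x : R) : `|x| <= 1 -> x ^+ 2 <= `|x|.
  by move=> x1; rewrite -real_normK ?num_real// expr2 ler_piMl.
by rewrite /split_loss/=; apply: lerD; apply: sqr_le; apply: norm_mean_le => z;
  [exact: norm_below_le|exact: norm_above_le].
Qed.

(** The parameter [e] stays free: it is chosen small first, and the squared loss is then made small
    compared with it. The factor 2 counts the two tests. *)
Lemma mean_norm_loss_le J n (e : R) : 0 < e ->
  mean_loss (fun x => `|x|) J n <=
  2 * e + e^-1 * mean_loss (fun x => x ^+ 2) J n.
Proof.
move=> e0; rewrite /mean_loss.
pose L (p : n.+1.-tuple Z * R) :=
  split_loss (fun x => x ^+ 2) (@clamped_residual R) p.1 p.2.
have bs : bounded_measurable L := bounded_measurable_split_loss n.+1
  (measurable_funX 2 (@measurable_id _ _ _)) unit_bounded_sqr.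
have bc (c : R) := bounded_measurable_cst (T := (n.+1.-tuple Z * R)%type) c.
have beL := bounded_measurableM (bc e^-1) bs.
rewrite -/L; have -> : 2 * e + e^-1 * \int[(iid J n.+1 \x U)%E]_p L p =
    \int[(iid J n.+1 \x U)%E]_p (2 * e + e^-1 * L p).
  by rewrite (prob_RintegralD (iid J n.+1 \x U)%E (bc _) beL)
    (prob_RintegralZl (iid J n.+1 \x U)%E e^-1 bs)
    (prob_Rintegral_cst (iid J n.+1 \x U)%E).
apply: prob_le_Rintegral => [||[S q]].
- exact: (bounded_measurable_split_loss _
    (@normr_measurable _ setT) unit_bounded_norm).
- exact: (bounded_measurableD (bc _) (bounded_measurableM (bc e^-1) bs)).
(* After multiplication by [e] this follows from the nonnegativity of the square of [e - |x|] and of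
   [e * |x|]. *)
have amgm (x : R) : `|x| <= e + e^-1 * x ^+ 2.
  rewrite -(ler_pM2l e0) mulrDr mulrA divff ?gt_eqF// mul1r.
  rewrite -(real_normK (num_real x)).
  by have := sqr_ge0 (e - `|x|); have := normr_ge0 x; nra.
by rewrite /L /split_loss/= mulrDr mulr_natl mulr2n addrACA lerD.
Qed.

End test_bias.

(** * Calibration and the population value *)

Section image_density.
Context d d' (T : measurableType d) (T' : measurableType d') (R : realType).
Variables (P : {measure set T -> \bar R}) (V : T -> T') (f : T -> R).
Hypotheses (mV : measurable_fun setT V) (mf : measurable_fun setT f).
Hypothesis f0 : forall x, 0 <= f x.

(* The hypotheses are arguments, so that the measure instance can be keyed on
   this constant. *)
Definition image_density (_ : measurable_fun setT V)
    (_ : measurable_fun setT f) (_ : forall x, 0 <= f x) (B : set T') : \bar R :=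
  (\int[P]_(x in V @^-1` B) (f x)%:E)%E.

Local Notation nu := (image_density mV mf f0).

Let nu0 : nu set0 = 0%E.
Proof. by rewrite /image_density preimage_set0 integral_set0. Qed.

Let nu_ge0 B : (0 <= nu B)%E.
Proof. by apply: integral_ge0 => x _; rewrite lee_fin. Qed.

Let nu_sigma_additive : semi_sigma_additive nu.
Proof.
move=> F mF tF mUF; rewrite /image_density preimage_bigcup; apply: cvg_toP.
  apply: ereal_nondecreasing_is_cvgn => m n mn.
  apply: lee_sum_nneg_natr => // k _ _.
  by apply: integral_ge0 => x _; rewrite lee_fin.
rewrite ge0_integral_bigcup//=.
- by move=> k; rewrite -[_ @^-1` _]setTI; exact: mV.
- by apply: measurable_funTS; exact/measurable_EFinP.
- by move=> x _; rewrite lee_fin.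
- apply/trivIsetP => i j _ _ ij; rewrite -preimage_setI.
  by move/trivIsetP : tF => ->//; rewrite preimage_set0.
Qed.

HB.instance Definition _ :=
  isMeasure.Build _ _ _ nu nu0 nu_ge0 nu_sigma_additive.

End image_density.

(** * Calibration as equality of integrals over events of v *)

Section calibration_test.
Context (R : realType).
Local Notation Z := (R * bool)%type.
Local Notation U := (uniform_prob (@ltr01 R)).
Variable J : probability Z R.
Hypothesis J1 : on_unit_interval J.

Let label (z : Z) : R := z.2%:R.
Let clamp (z : Z) : R := unit_clamp z.1.

Let bounded_measurable_label : bounded_measurable label.
Proof.
split; first by apply: (measurableT_comp (@measurable_natr_bool R)).
by exists 1 => z; rewrite /label normr_nat; case: z.2 => /=; rewrite ?lexx ?ler01.
Qed.

Let bounded_measurable_clamp : bounded_measurable clamp.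
Proof.
split; first by apply: (measurableT_comp (@measurable_unit_clamp R)).
exists 1 => z; have /andP[c0 c1] := unit_clamp_itv z.1.
by rewrite /clamp ger0_norm.
Qed.

Let measurable_unit_itv : measurable (`[0, 1]%classic `*` [set: bool] : set Z).
Proof. exact: measurableX. Qed.

Lemma ae_unit_clamp : {ae J, forall z, unit_clamp z.1 = z.1}.
Proof.
exists (~` (`[0, 1]%classic `*` [set: bool])); split.
- exact: measurableC measurable_unit_itv.
- have JC : J (~` (`[0, 1]%classic `*` [set: bool])) = 0%E.
    by rewrite probability_setC// [X in (_ - X)%E]J1 subee.
  exact: JC.
- by move=> z /= nz [v01 _]; apply: nz; apply: unit_clamp_id;
    rewrite /= in_itv/= in v01.
Qed.

(** The defining identity of conditional expectation on the event that v lies in [B], with v clamped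
    so that both integrands are bounded. *)
Definition unbiased_on (B : set R) : Prop :=
  (\int[J]_(z in fst @^-1` B) (clamp z)%:E =
   \int[J]_(z in fst @^-1` B) (label z)%:E)%E.

Let measurable_fst_preimage (B : set R) :
  measurable B -> measurable (fst @^-1` B : set Z).
Proof. by move=> mB; rewrite -[_ @^-1` _]setTI; exact: measurable_fst. Qed.

(** Forwards, any version of the conditional expectation equals v, hence the clamped v, almost
    surely. Backwards, [unit_clamp] itself serves as the version. *)
Lemma calibrated_unbiased :
  calibrated J <-> forall B, measurable B -> unbiased_on B.
Proof.
split=> [[g [mg ig gP] gid] B mB|unb].
  rewrite /unbiased_on /label -gP//; apply: ae_eq_integral.
  - exact: measurable_fst_preimage.
  - by apply: measurable_funTS; apply/measurable_EFinP;
      case: bounded_measurable_clamp.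
  - by apply: measurable_funTS; apply/measurable_EFinP;
      exact: (measurableT_comp mg measurable_fst).
  - by apply: filterS2 ae_unit_clamp gid => z cz gz _; rewrite /clamp cz gz.
exists (@unit_clamp R); last exact: ae_unit_clamp.
split; [exact: measurable_unit_clamp| |exact: unb].
exact: bounded_measurable_integrable bounded_measurable_clamp.
Qed.

(** Translates between threshold tests and [unbiased_on]: the half-lines below and above [q] turn
    the left side into [test_below J q] and [test_above J q]. *)
Lemma Rintegral_clamped_residual_indic (B : set R) : measurable B ->
  \int[J]_z (clamped_residual z * \1_B z.1) =
  fine (\int[J]_(z in fst @^-1` B) (clamp z)%:E) -
  fine (\int[J]_(z in fst @^-1` B) (label z)%:E).
Proof.
move=> mB.
have mD := measurable_fst_preimage mB.
have bi (f : Z -> R) : bounded_measurable f ->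
    J.-integrable (fst @^-1` B : set Z) (EFin \o f).
  move=> bf; apply: (integrableS measurableT) => //.
  exact: bounded_measurable_integrable.
rewrite -/(Rintegral J (fst @^-1` B) clamp) -/(Rintegral J (fst @^-1` B) label).
rewrite -RintegralB//; [|exact: bi..].
rewrite [RHS]Rintegral_mkcond; apply: eq_Rintegral => z _.
rewrite patchE indicE.
have -> : (z \in fst @^-1` B) = (z.1 \in B) by apply/idP/idP; rewrite !inE.
by case: ifPn => _; rewrite ?mulr1 ?mulr0.
Qed.

Lemma calibrated_test_eq0 q : calibrated J ->
  test_below J q = 0 /\ test_above J q = 0.
Proof.
move=> /calibrated_unbiased unb; split.
  transitivity (\int[J]_z (clamped_residual z * \1_(`]-oo, q[%classic) z.1)).
    apply: eq_Rintegral => z _; rewrite /below indicE mem_setE.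
    by rewrite in_itv.
  by rewrite Rintegral_clamped_residual_indic// unb// subrr.
transitivity (\int[J]_z (clamped_residual z * \1_(`[q, +oo[%classic) z.1)).
  apply: eq_Rintegral => z _; rewrite /above indicE mem_setE.
    by rewrite in_itv/= andbT.
by rewrite Rintegral_clamped_residual_indic// unb// subrr.
Qed.

(** The clamped v and the label are densities of two finite measures, whose images under v agree on
    all open left half-lines. These form a pi-system that generates the Borel sets and exhausts the
    line, so the images are equal. *)
Lemma test_below_eq0_calibrated : (forall q, test_below J q = 0) -> calibrated J.
Proof.
move=> t0; apply/calibrated_unbiased => B mB.
have clamp0 z : 0 <= clamp z by have /andP[] := unit_clamp_itv z.1.
have label0 z : 0 <= label z by exact: ler0n.
have [mclamp _] := bounded_measurable_clamp.
have [mlabel _] := bounded_measurable_label.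
have fin (f : Z -> R) (D : set R) : measurable D -> bounded_measurable f ->
    (\int[J]_(z in fst @^-1` D) (f z)%:E)%E \is a fin_num.
  move=> mD bf; apply: integrable_fin_num; first exact: measurable_fst_preimage.
  apply: (integrableS measurableT) => //; first exact: measurable_fst_preimage.
  exact: bounded_measurable_integrable.
pose nu1 : {measure set R -> \bar R} :=
  image_density J (@measurable_fst _ _ R bool) mclamp clamp0.
pose nu2 : {measure set R -> \bar R} :=
  image_density J (@measurable_fst _ _ R bool) mlabel label0.
suff : nu1 B = nu2 B by [].
apply: (measure_unique (@RGenInftyO.G R) (fun n => `]-oo, n%:R[%classic)) => //.
- exact: RGenInftyO.measurableE.
- move=> _ _ [x ->] [y ->]; exists (Num.min x y).
  by apply/seteqP; split => v /=; rewrite !in_itv/= lt_min; [move=> [-> ->]|move=> /andP].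
- by move=> n; exists n%:R.
- apply/seteqP; split => // v _; exists (Num.bound `|v|) => //=.
  by rewrite in_itv/= (le_lt_trans (ler_norm v))// archi_boundP.
- move=> _ [q ->]; rewrite /nu1 /nu2 /= /image_density.
  apply/eqP; rewrite -(fineK (fin clamp _ _ _))// -(fineK (fin label _ _ _))// eqe.
  rewrite -subr_eq0 -Rintegral_clamped_residual_indic// -[X in _ == X](t0 q).
  apply/eqP/eq_Rintegral => z _; rewrite /below indicE mem_setE.
    by rewrite in_itv.
- by move=> n; rewrite /= -ge0_fin_numE ?fin//; exact: measure_ge0.
Qed.

End calibration_test.

(** * Vanishing of the population value forces all lower tests to vanish *)

Section population_ATB_zero.
Context (R : realType).
Local Notation Z := (R * bool)%type.
Local Notation U := (uniform_prob (@ltr01 R)).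
Variable J : probability Z R.
Hypothesis J1 : on_unit_interval J.

Lemma uniform_prob_oo (a b : R) : 0 <= a -> a < b -> b <= 1 ->
  U `]a, b[%classic = (b - a)%:E.
Proof.
move=> a0 ab b1; rewrite /uniform_prob integral_uniform_pdf.
rewrite setIidl; last first.
  move=> x /=; rewrite !in_itv/= => /andP[ax xb].
  by rewrite (le_trans a0 (ltW ax)) (le_trans (ltW xb) b1).
rewrite (eq_integral (fun=> 1%E)); last first.
  move=> x; rewrite inE/= in_itv/= => /andP[ax xb]; rewrite /uniform_pdf.
  by rewrite (le_trans a0 (ltW ax)) (le_trans (ltW xb) b1) subr0 invr1.
by rewrite integral_cst//= mul1e lebesgue_measure_itv/= lte_fin ab EFinB.
Qed.

Lemma population_ATB_ge0 : 0 <= population_ATB J.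
Proof. by apply: Rintegral_ge0 => q _; rewrite addr_ge0 ?sqr_ge0. Qed.

(** A nonnegative function with zero integral vanishes almost everywhere. Without a common zero of
    the tests, the interval would lie in a null set although its uniform measure is b - a > 0. *)
Lemma population_ATB_eq0_dense (a b : R) : population_ATB J = 0 ->
  0 <= a -> a < b -> b <= 1 ->
  exists2 q, a < q < b & test_below J q = 0 /\ test_above J q = 0.
Proof.
move=> c0 a0 ab b1; apply: contrapT => noq.
have bt := bounded_measurable_sqr_test J.
have t0 q : 0 <= test_below J q ^+ 2 + test_above J q ^+ 2.
  by rewrite addr_ge0 ?sqr_ge0.
pose t q := (test_below J q ^+ 2 + test_above J q ^+ 2)%:E.
have mt : measurable_fun setT t by apply/measurable_EFinP; case: bt.
have [N [mN N0 subN]] : ae_eq U setT t (cst 0%E).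
  apply: (ae_eq_integral_abs U measurableT mt).1.
  transitivity (\int[U]_q t q)%E.
    by apply: eq_integral => q _; rewrite gee0_abs ?lee_fin.
  by rewrite -EFin_Rintegral//; congr EFin.
have : (U `]a, b[%classic <= U N)%E.
  apply: le_measure; rewrite ?inE//.
  move=> q /=; rewrite in_itv/= => aqb; apply: subN => /= /(_ I) [].
  move/eqP; rewrite paddr_eq0 ?sqr_ge0// !sqrf_eq0 => /andP[/eqP ? /eqP ?].
  by apply: noq; exists q.
by rewrite uniform_prob_oo// [X in (_ <= X)%E]N0 lee_fin subr_le0 leNgt ab.
Qed.

Lemma below_add_above (h : Z -> R) q z : below h q z + above h q z = h z.
Proof.
by rewrite /below /above leNgt; case: (z.1 < q); rewrite ?mulr1 ?mulr0 ?addr0 ?add0r.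
Qed.

Lemma population_ATB_eq0_test_below : population_ATB J = 0 ->
  forall q, test_below J q = 0.
Proof.
move=> c0 q; have mI : measurable (`[0, 1]%classic `*` [set: bool] : set Z).
  exact: measurableX.
have [mq _] := bounded_measurable_below q.
(* For [q <= 0] the event v < q is null. *)
have [q0|q0] := leP q 0.
  rewrite -[RHS](prob_Rintegral_cst J 0) /test_below /Rintegral; congr fine.
  apply: (eq_Rintegral_full mI J1) => // z [/= z01 _].
  rewrite /below ltNge (le_trans q0) ?mulr0//.
  by move: z01; rewrite in_itv => /andP[].
(* For [q > 1] the event v < q has full measure, so the test is the expectation of the whole
   residual, which is the sum of the two tests at any common zero [p]. *)
have [q1|q1] := ltP 1 q.
  have [p _ [b0 a0]] := population_ATB_eq0_dense c0 (lexx 0) ltr01 (lexx 1).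
  transitivity (test_below J p + test_above J p); last by rewrite b0 a0 addr0.
  rewrite -prob_RintegralD;
    [|exact: bounded_measurable_below|exact: bounded_measurable_above].
  rewrite /test_below /Rintegral; congr fine.
  apply: (eq_Rintegral_full mI J1) => //.
    apply: measurable_funD; first by case: (bounded_measurable_below p).
    by case: (bounded_measurable_above p).
  move=> z [/= z01 _]; rewrite below_add_above /below (le_lt_trans _ q1) ?mulr1//.
  by move: z01; rewrite in_itv => /andP[].
(* For q in ]0, 1], zeros of the test approach q strictly from the left; the maximum with 0 keeps
   the searched interval inside [0, 1]. *)
have near_q (k : nat) : exists2 p, q - k.+1%:R^-1 < p < q & test_below J p = 0.
  have [||p /andP[lp pq] [tp _]] := @population_ATB_eq0_dense
      (Num.max 0 (q - k.+1%:R^-1)) q c0 _ _ q1.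
  - by rewrite le_max lexx.
  - by rewrite gt_max q0/= gtrBl invr_gt0 ltr0n.
  exists p => //; rewrite pq andbT (le_lt_trans _ lp)//.
  by rewrite le_max lexx orbT.
have /choice[p pP] : forall k : nat, exists p,
    q - k.+1%:R^-1 < p < q /\ test_below J p = 0.
  by move=> k; have [p ? ?] := near_q k; exists p.
have cvg_below : {ae J, forall z, setT z ->
    (below (@clamped_residual R) (p k) z)%:E @[k --> \oo] -->
    (below (@clamped_residual R) q z)%:E}.
  (* The strict inequality v < q makes the test left continuous in q: if v < q, then eventually v <
     p k; if v >= q, then v > p k for every k. The sequence is thus eventually constant at every
     point. *)
  apply: aeW => z _; apply: cvg_near_cst.
  have [zq|qz] := ltP z.1 q; last first.
    apply: nearW => k; have [/andP[_ pq] _] := pP k.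
    by rewrite /below !ltNge qz (le_trans (ltW pq) qz).
  have e0 : 0 < q - z.1 by rewrite subr_gt0.
  have := near_infty_natSinv_lt (PosNum e0).
  apply: filterS => k /= ke; have [/andP[qp _] _] := pP k.
  by rewrite /below zq (lt_trans _ qp)// ltrBrDr addrC -ltrBrDr.
have mp k : measurable_fun [set: Z] (fun z => (below (@clamped_residual R) (p k) z)%:E).
  by apply/measurable_EFinP; case: (bounded_measurable_below (p k)).
have mEq : measurable_fun [set: Z] (fun z => (below (@clamped_residual R) q z)%:E).
  exact/measurable_EFinP.
have ig : J.-integrable [set: Z] (cst 1%E) :=
  finite_measure_integrable_cst J 1 measurableT.
have dom : {ae J, forall z k, setT z ->
    (`|(below (@clamped_residual R) (p k) z)%:E| <= cst 1 z)%E}.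
  by apply: aeW => z k _; rewrite /= lee_fin norm_below_le.
have [_ _] := dominated_convergence measurableT mp mEq cvg_below ig dom.
rewrite (_ : [sequence _]_n = cst 0%E); last first.
  apply/funext => k /=; rewrite -EFin_Rintegral; last exact: bounded_measurable_below.
  by have [_] := pP k; rewrite /test_below => ->.
rewrite -EFin_Rintegral; last exact: bounded_measurable_below.
by move=> /(cvg_lim (@ereal_hausdorff R)); rewrite lim_cst// => -[].
Qed.

End population_ATB_zero.

(** * Completeness and soundness *)

Section completeness_soundness.
Context (R : realType).
Implicit Types J : probability (R * bool)%type R.

Lemma expected_empirical_ATB J n : on_unit_interval J ->
  expected_empirical (@ATB R) J n = (mean_loss (fun x => x ^+ 2) J n)%:E.
Proof.
apply: (expected_empirical_tested_bias (psi := fun x => x ^+ 2)).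
- exact: measurable_funX.
- exact: sqr_ge0.
- exact: unit_bounded_sqr.
Qed.

Lemma expected_empirical_l1_ATB J n : on_unit_interval J ->
  expected_empirical (@l1_ATB R) J n = (mean_loss (fun x => `|x|) J n)%:E.
Proof.
apply: (expected_empirical_tested_bias (psi := fun x => `|x|)).
- exact: normr_measurable.
- exact: normr_ge0.
- exact: unit_bounded_norm.
Qed.

Lemma calibrated_population_ATB J : on_unit_interval J ->
  calibrated J <-> population_ATB J = 0.
Proof.
move=> J1; split=> [cJ|c0].
  rewrite -[RHS](prob_Rintegral_cst (uniform_prob (@ltr01 R)) 0).
  apply: eq_Rintegral => q _; have [-> ->] := calibrated_test_eq0 J1 q cJ.
  by rewrite expr0n addr0.
by apply: test_below_eq0_calibrated => //; exact: population_ATB_eq0_test_below.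
Qed.

Lemma population_ATB_gt0 J : on_unit_interval J -> ~ calibrated J ->
  0 < population_ATB J.
Proof.
move=> J1 ncal; rewrite lt_neqAle population_ATB_ge0 andbT eq_sym.
by apply/eqP => c0; apply: ncal; exact/calibrated_population_ATB.
Qed.

Lemma limn_einf_ge (u : (\bar R)^nat) (l : \bar R) :
  (forall n, (l <= u n)%E) -> (l <= limn_einf u)%E.
Proof.
move=> lu; rewrite limn_einf_lim; apply: lime_ge; first exact: is_cvg_einfs.
by apply: nearW => n; apply: le_ereal_inf_tmp => _ [m /= _ <-].
Qed.

Lemma cvg_mean_sqr_loss J :
  mean_loss (fun x => x ^+ 2) J n @[n --> \oo] --> population_ATB J.
Proof.
apply: (@squeeze_cvgr _ _ _ _ (fun=> population_ATB J)
  (* [harmonic n] is the inverse of n + 1, the sample size at index n. *)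
  (fun n => population_ATB J + 2 * harmonic n)).
- by apply: nearW => n; exact: mean_sqr_loss_bounds.
- exact: cvg_cst.
- rewrite -[X in _ --> X]addr0 -[X in _ --> _ + X](mulr0 2).
  by apply: cvgD; [exact: cvg_cst|apply: cvgMr; exact: cvg_harmonic].
Qed.

Lemma ATB_complete : complete_measure (@ATB R).
Proof.
move=> J J1 /(calibrated_population_ATB J1) c0.
under eq_fun do rewrite expected_empirical_ATB//.
by apply/fine_cvgP; split; [exact: nearW|rewrite -c0; exact: cvg_mean_sqr_loss].
Qed.

Lemma l1_ATB_complete : complete_measure (@l1_ATB R).
Proof.
move=> J J1 /(calibrated_population_ATB J1) c0.
under eq_fun do rewrite expected_empirical_l1_ATB//.
apply/fine_cvgP; split; first exact: nearW.
apply/cvgr0Pnorm_lt => e e0.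
(* With parameter e / 4 the bound on the absolute loss is e / 2 plus the squared loss divided by e /
   4. Once the squared loss is below the square of e / 4, the total is below 3e / 4. *)
have e4 : 0 < e / 4 by rewrite divr_gt0.
have /cvgr0Pnorm_lt/(_ (e / 4 * (e / 4)) (mulr_gt0 e4 e4)) :
  mean_loss (fun x => x ^+ 2) J n @[n --> \oo] --> 0.
  by rewrite -c0; exact: cvg_mean_sqr_loss.
apply: filterS => n /= sqr_lt.
have sqr_ge : 0 <= mean_loss (fun x => x ^+ 2) J n.
  by have /andP[+ _] := mean_sqr_loss_bounds J n; rewrite c0.
have norm_ge := le_trans sqr_ge (mean_sqr_loss_le_norm J n).
rewrite ger0_norm//; apply: (le_lt_trans (mean_norm_loss_le J n e4)).
rewrite ger0_norm// in sqr_lt.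
have : (e / 4)^-1 * mean_loss (fun x => x ^+ 2) J n < e / 4.
  by rewrite mulrC ltr_pdivrMr.
by move=> lt4; lra.
Qed.

(** The positive constant [population_ATB J] bounds the expectation from below at every sample size,
    hence also the lower limit. *)
Lemma ATB_sound : sound_measure (@ATB R).
Proof.
move=> J J1 ncal; apply: (@lt_le_trans _ _ (population_ATB J)%:E).
  by rewrite lte_fin population_ATB_gt0.
apply: limn_einf_ge => n; rewrite expected_empirical_ATB// lee_fin.
by have /andP[] := mean_sqr_loss_bounds J n.
Qed.

Lemma l1_ATB_sound : sound_measure (@l1_ATB R).
Proof.
move=> J J1 ncal; apply: (@lt_le_trans _ _ (population_ATB J)%:E).
  by rewrite lte_fin population_ATB_gt0.
apply: limn_einf_ge => n; rewrite expected_empirical_l1_ATB// lee_fin.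
apply: le_trans (mean_sqr_loss_le_norm J n).
by have /andP[] := mean_sqr_loss_bounds J n.
Qed.

End completeness_soundness.

Theorem theorem4p3 (R : realType) :
  (complete_measure (@ATB R) /\ sound_measure (@ATB R)) /\
  (complete_measure (@l1_ATB R) /\ sound_measure (@l1_ATB R)).
Proof.
split; split.
- exact: ATB_complete.
- exact: ATB_sound.
- exact: l1_ATB_complete.
- exact: l1_ATB_sound.
Qed.
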